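(* Let $P$ be a $\mu$-reversible Markov kernel on $(E,\mathscr{E})$ and let $\Phi$ be a $P$-non-expansive sieve such that for all $f\in L^2_0(\mu)$ with $0<\Phi(f)<\infty$, $$\frac{\mathcal{E}(P^*P,f)}{\Phi(f)}\ge K^*\left(\frac{\|f\|_2^2}{\Phi(f)}\right).$$ Assume also that the map $v\mapsto v-K^*(v)$ is increasing on $(0,\mathfrak{a}]$. Define $B(v)=\int_0^v\frac{w}{K^*(w)}\,\mathrm{d}w$, which is assumed to be finite for $v\in[0,\mathfrak{a}]$. Then, for every $f\in L^2_0(\mu)$ with $0<\Phi(f)<\infty$, the asymptotic variance of $f$ can be bounded as $$\mathrm{var}(P,f)\le4\cdot\Phi(f)\cdot B\left(\frac{\|f\|_2^2}{\Phi(f)}\right).$$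
   Context: $(E,\mathscr{E})$ is a measurable space, $\mu$ a probability measure on it. $L^2_0(\mu)$ is the set of real $f\in L^2(\mu)$ with $\mu(f)=0$; $\mathcal{E}(T,f)=\langle(\mathrm{Id}-T)f,f\rangle$ in $L^2(\mu)$; $P^*$ is the adjoint of $P$. Sieve: $\Phi:L^2(\mu)\to[0,\infty]$ with $\Phi(cf)=c^2\Phi(f)$ for $c>0$ and $\|f-\mu(f)\|_2^2\le\mathfrak{a}\,\Phi(f-\mu(f))$ for all $f\in L^2(\mu)$, where the constant $\mathfrak{a}:=\sup_{f\in L^2_0(\mu)\setminus\{0\}}\|f\|_2^2/\Phi(f)$ is finite. It is $P$-non-expansive if $\Phi(Pf)\le\Phi(f)$ for all $f\in L^2_0(\mu)$. $K^*:[0,\infty)\to[0,\infty]$ is the convex conjugate $K^*(v)=\sup_{u\ge0}\{uv-K(u)\}$ of $K(u)=u\,\beta(1/u)$ for $u>0$, $K(0)=0$, where $\beta:(0,\infty)\to[0,\infty)$ is a decreasing function with $\beta(s)\to0$ as $s\to\infty$. Asymptotic variance: $\mathrm{var}(P,f)=\lim_{n\to\infty}n\,\mathrm{var}\left(\frac1n\sum_{i=1}^nf(X_i)\right)$, where $(X_i)$ is the stationary Markov chain with kernel $P$ and initial law $\mu$. *)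

(* Defs.v *)
(* MathComp-Analysis development, over an arbitrary R : realType. *)
From HB Require Import structures.
From mathcomp Require Import all_boot all_order all_algebra.
From mathcomp Require Import all_classical all_reals all_analysis.

Set Implicit Arguments.
Unset Strict Implicit.
Unset Printing Implicit Defensive.
Import Order.TTheory GRing.Theory Num.Theory.
Import numFieldNormedType.Exports.
Local Open Scope classical_set_scope.
Local Open Scope ring_scope.

(* An element of L^2(mu) is represented by a square-integrable function; the
   functionals and operators below are only ever constrained on such functions,
   and have to respect equality mu-almost everywhere. *)
Section L2.
Context (d : measure_display) (E : measurableType d) (R : realType).
Variable mu : probability E R.
Implicit Types (f g : E -> R) (T S : (E -> R) -> E -> R).

Definition L2 : set (E -> R) := [set f | f \in Lfun mu 2%:E].

Definition mean f : R := \int[mu]_x f x.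

Definition L20 : set (E -> R) := [set f | L2 f /\ mean f = 0].

Definition sqnorm f : R := fine ('N[mu]_2%:E[EFin \o f])%E ^+ 2.

Definition inner f g : R := \int[mu]_x (f x * g x).

Definition dirichlet T f : R := inner (f \- T f) f.

Definition is_adjoint T S : Prop :=
  (forall f, L2 f -> L2 (S f)) /\
  (forall f g, L2 f -> L2 g -> inner (T f) g = inner f (S g)).

End L2.

Section Kernel.
Context (d : measure_display) (E : measurableType d) (R : realType).
Implicit Types (mu : probability E R) (P : R.-pker E ~> E).

(* For f in L^2(mu) and P mu-invariant, f is P(x, .)-integrable for mu-almost
   every x; at the other points the value is that of the total operator
   \int, which is harmless in L^2(mu). *)
Definition kernel_op P (f : E -> R) : E -> R := fun x => \int[P x]_y f y.

Definition reversible mu P : Prop := forall A B : set E,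
  measurable A -> measurable B ->
  (\int[mu]_(x in A) P x B = \int[mu]_(x in B) P x A)%E.

End Kernel.

Section Sieve.
Context (d : measure_display) (E : measurableType d) (R : realType).
Variables (mu : probability E R) (Phi : (E -> R) -> \bar R).
Local Open Scope ereal_scope.

(* The supremum is taken in [0, +oo], so that it is 0 over the empty set.
   Extended division satisfies x / 0 = +oo for 0 < x and x / +oo = 0. *)
Definition sieve_const : \bar R :=
  maxe 0 (ereal_sup [set (sqnorm mu f)%:E / Phi f | f in
    [set f | L20 mu f /\ ~ (f = cst 0%R %[ae mu])]]).

Record is_sieve : Prop := IsSieve {
  sieve_ae : forall f g, L2 mu f -> L2 mu g -> f = g %[ae mu] -> Phi f = Phi g ;
  sieve_ge0 : forall f, L2 mu f -> 0 <= Phi f ;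
  sieve_homogeneous : forall (c : R) f, (0 < c)%R -> L2 mu f ->
    Phi (fun x => c * f x)%R = (c ^+ 2)%:E * Phi f ;
  sieve_const_lty : sieve_const < +oo ;
  sieve_bound : forall f, L2 mu f ->
    (sqnorm mu (fun x => f x - mean mu f)%R)%:E <=
    sieve_const * Phi (fun x => f x - mean mu f)%R }.

Definition nonexpansive (P : R.-pker E ~> E) : Prop :=
  forall f, L20 mu f -> Phi (kernel_op P f) <= Phi f.

End Sieve.

Section Conjugate.
Context (R : realType).
Variable beta : R -> R.

Record is_rate : Prop := IsRate {
  rate_ge0 : forall s, 0 < s -> 0 <= beta s ;
  rate_decreasing : forall s t, 0 < s -> s <= t -> beta t <= beta s ;
  rate_cvg0 : beta s @[s --> +oo] --> 0 }.

Definition Kfun (u : R) : R := if 0 < u then u * beta u^-1 else 0.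

Local Open Scope ereal_scope.

Definition Kstar (v : R) : \bar R :=
  ereal_sup [set (u * v - Kfun u)%:E | u in [set u | (0 <= u)%R]].

Definition Bfun (v : R) : \bar R :=
  \int[lebesgue_measure]_(w in `[0%R, v]) (w%:E / Kstar w).

End Conjugate.

Section Chain.
Context (d : measure_display) (E : measurableType d) (R : realType).
Context (d' : measure_display) (Omega : measurableType d').
Variables (Pr : probability Omega R) (X : nat -> {RV Pr >-> E}).

Definition history (n : nat) : set (set Omega) :=
  <<s \bigcup_(i in [set i | (i <= n)%N])
        preimage_set_system setT (X i) measurable >>.

(* The second clause says that P(X_n, A) is a version of the conditional
   probability of X_{n+1} in A given the sigma-algebra of X_0, ..., X_n. *)
Definition is_markov_chain (mu : probability E R) (P : R.-pker E ~> E) : Prop :=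
  (forall A, measurable A -> Pr (X 0%N @^-1` A) = mu A) /\
  (forall n A C, measurable A -> history n C ->
     (Pr (C `&` X n.+1 @^-1` A) = \int[Pr]_(w in C) P (X n w) A)%E).

Definition scaled_variance (f : E -> R) (n : nat) : \bar R :=
  (n%:R%:E *
   'V_Pr[(fun w => n%:R^-1 * \sum_(1 <= i < n.+1) f (X i w))%R])%E.

Definition asymptotic_variance (f : E -> R) : \bar R :=
  limn (scaled_variance f).

End Chain.

(* Main.v *)
(* Expanding n Var((1/n) sum f(X_i)) as the Cesaro means of
   a_0 + 2 sum_(0 < k <= n) a_k with a_k = <f, P^k f>, reversibility gives
   |a_n| <= b_(n/2) for b_k = |P^k f|^2, so that var(P, f) <= 4 sum_k b_k.
   Put v_k = b_k / Phi(f). As K* is convex with K*(0) = 0 and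
   Phi(P^k f) <= Phi(f), the functional inequality at P^k f yields
   K*(v_k) <= v_k - v_(k+1); as w / K*(w) is nonincreasing,
   v_k <= B(v_k) - B(v_(k+1)), and the sum telescopes to sum_k v_k <= B(v_0). *)
Require Import Defs.
From HB Require Import structures.
From mathcomp Require Import all_boot all_order all_algebra finmap.
From mathcomp Require Import all_classical all_reals all_analysis.
From mathcomp Require Import measurable_realfun zify ring lra.

Set Implicit Arguments.
Unset Strict Implicit.
Unset Printing Implicit Defensive.
Import Order.TTheory GRing.Theory Num.Theory.
Import numFieldNormedType.Exports.
Local Open Scope classical_set_scope.
Local Open Scope ring_scope.

(** Reversibility and the Markov property are given on events, whereas correlations need them as
    identities between inner products on all of L^2. In both cases the defect is a bounded bilinear
    form that vanishes on pairs of indicators, and density is applied in one argument after the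
    other. As [kernel_op] is a total integral, it is linear only almost everywhere, so null sets
    have to be carried along. The constant 4 is 2 times 2: one factor counts the symmetric pairs in
    the variance, the other comes from a_(2k) and a_(2k+1) sharing the bound b_k. The functional
    inequality says nothing about P^k f when Phi(P^k f) = 0; the sieve bound then forces b_k = 0. *)

(** * The inner product of L^2(mu) *)

Section L2_theory.
Context (d : measure_display) (E : measurableType d) (R : realType).
Variable mu : probability E R.
Implicit Types f g h : E -> R.

Lemma L2P f : L2 mu f <->
  measurable_fun setT f /\ mu.-integrable setT (fun x => (f x ^+ 2)%:E).
Proof.
split=> [Lf|[mf fi]].
  by split; [case/andP: (Lf) => /[!inE]|exact: Lfun2_integrable_sqr Lf].
rewrite /L2/=; apply/andP; split; rewrite inE//= /finite_norm unlock/=.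
apply: poweR_lty.
have -> : (\int[mu]_x (`|f x| `^ 2)%:E = \int[mu]_x (f x ^+ 2)%:E)%E.
  by apply: eq_integral => x _; rewrite powR_mulrn// real_normK ?num_real.
exact: integrable_lty.
Qed.

Lemma L2_measurable f : L2 mu f -> measurable_fun setT f.
Proof. by case/L2P. Qed.

Lemma L2_integrableM f g : L2 mu f -> L2 mu g ->
  mu.-integrable setT (fun x => (f x * g x)%:E).
Proof. by move=> Lf Lg; apply/Lfun1_integrable; exact: Lfun2_mul_Lfun1. Qed.

Lemma L2_integrable f : L2 mu f -> mu.-integrable setT (EFin \o f).
Proof.
move=> Lf; apply/Lfun1_integrable; apply: Lfun_subset12 Lf.
exact: fin_num_measure.
Qed.

Lemma L2_cst (c : R) : L2 mu (cst c).
Proof. exact: Lfun_cst. Qed.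

Lemma L2Z (c : R) f : L2 mu f -> L2 mu (fun x => c * f x).
Proof.
move=> Lf; rewrite (_ : (fun x => _) = c \o* f); first last.
  by apply/funext => x /=; rewrite mulrC.
by apply: Lfun_scale => //; rewrite ler1n.
Qed.

Lemma L2D f g : L2 mu f -> L2 mu g -> L2 mu (fun x => f x + g x).
Proof.
by move=> Lf Lg; have := @Lfun_addr_closed _ _ _ mu 2%:E (lee1n 2);
  case=> _; apply.
Qed.

Lemma L2B f g : L2 mu f -> L2 mu g -> L2 mu (fun x => f x - g x).
Proof.
move=> Lf Lg; rewrite (_ : (fun x => _) = (fun x => f x + -1 * g x)).
  by apply: L2D => //; exact: L2Z.
by apply/funext => x; rewrite mulN1r.
Qed.

Lemma L2_indic A : measurable A -> L2 mu \1_A.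
Proof.
move=> mA; apply/L2P; split; first exact: measurable_indic.
apply: (@le_integrable _ _ _ mu _ _ _ (EFin \o cst 1)) => //.
- by apply/measurable_EFinP; apply: measurable_funX; exact: measurable_indic.
- move=> x _; rewrite lee_fin /= normr1 indicE normrX normr_nat.
  by case: (x \in A); rewrite ?expr0n ?expr1n ?ler01.
- exact: finite_measure_integrable_cst.
Qed.

Lemma le_L2 f g : measurable_fun setT f -> (forall x, `|f x| <= `|g x|) ->
  L2 mu g -> L2 mu f.
Proof.
move=> mf fg /L2P[mg gi]; apply/L2P; split => //.
apply: le_integrable gi => //.
  by apply/measurable_EFinP; exact: measurable_funX.
by move=> x _; rewrite lee_fin !normrX lerXn2r ?nnegrE.
Qed.

Lemma EFin_inner f g : L2 mu f -> L2 mu g ->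
  ((inner mu f g)%:E = \int[mu]_x (f x * g x)%:E)%E.
Proof.
move=> Lf Lg; rewrite fineK//; apply: integrable_fin_num => //.
exact: L2_integrableM.
Qed.

Lemma innerC f g : inner mu f g = inner mu g f.
Proof. by apply: eq_Rintegral => x _; rewrite mulrC. Qed.

Lemma innerDl f g h : L2 mu f -> L2 mu g -> L2 mu h ->
  inner mu (fun x => f x + g x) h = inner mu f h + inner mu g h.
Proof.
move=> Lf Lg Lh; rewrite /inner -RintegralD//; [|exact: L2_integrableM..].
by apply: eq_Rintegral => x _; rewrite mulrDl.
Qed.

Lemma innerZl (c : R) f h : L2 mu f -> L2 mu h ->
  inner mu (fun x => c * f x) h = c * inner mu f h.
Proof.
move=> Lf Lh; rewrite /inner -RintegralZl//; last exact: L2_integrableM.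
by apply: eq_Rintegral => x _; rewrite mulrA.
Qed.

Lemma innerBl f g h : L2 mu f -> L2 mu g -> L2 mu h ->
  inner mu (fun x => f x - g x) h = inner mu f h - inner mu g h.
Proof.
move=> Lf Lg Lh; rewrite /inner -RintegralB//; [|exact: L2_integrableM..].
by apply: eq_Rintegral => x _; rewrite mulrBl.
Qed.

Lemma innerDr f g h : L2 mu f -> L2 mu g -> L2 mu h ->
  inner mu h (fun x => f x + g x) = inner mu h f + inner mu h g.
Proof. by move=> *; rewrite !(innerC h) innerDl. Qed.

Lemma innerZr (c : R) f h : L2 mu f -> L2 mu h ->
  inner mu h (fun x => c * f x) = c * inner mu h f.
Proof. by move=> *; rewrite !(innerC h) innerZl. Qed.

Lemma inner_ge0 f : 0 <= inner mu f f.
Proof. by apply: Rintegral_ge0 => x _; rewrite -expr2 sqr_ge0. Qed.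

Lemma eq_inner_ae f g h : L2 mu f -> L2 mu g -> L2 mu h ->
  ae_eq mu setT f g -> inner mu f h = inner mu g h.
Proof.
move=> Lf Lg Lh fg; rewrite /inner /Rintegral; congr fine.
apply: ae_eq_integral => //.
- exact: (measurable_int _ (L2_integrableM Lf Lh)).
- exact: (measurable_int _ (L2_integrableM Lg Lh)).
- by apply: filterS fg => x /= /[apply] ->.
Qed.

Lemma sqnormE f : L2 mu f -> sqnorm mu f = inner mu f f.
Proof.
move=> Lf; rewrite /sqnorm unlock/=.
have -> : (\int[mu]_x (`|f x| `^ 2)%:E = \int[mu]_x (f x * f x)%:E)%E.
  by apply: eq_integral => x _; rewrite powR_mulrn// real_normK ?num_real.
rewrite -EFin_inner//= -powR_mulrn ?powR_ge0// -powRrM mulVf//.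
by rewrite powRr1// inner_ge0.
Qed.

(** The form |s f + t g|^2 is nonnegative for all s and t; suitable values of s and t give the
    inequality. *)
Lemma cauchy_schwarz f g : L2 mu f -> L2 mu g ->
  inner mu f g ^+ 2 <= inner mu f f * inner mu g g.
Proof.
move=> Lf Lg.
have expand s t : 0 <= s ^+ 2 * inner mu f f + 2 * s * t * inner mu f g
    + t ^+ 2 * inner mu g g.
  have := inner_ge0 (fun x => s * f x + t * g x).
  have Ls := L2Z s Lf; have Lt := L2Z t Lg; have Lst := L2D Ls Lt.
  rewrite innerDl// !innerDr// !innerZl// !innerZr// (innerC g f).
  by congr (0 <= _); ring.
have := inner_ge0 f; rewrite le_eqVlt => /predU1P[f0|f0].
  rewrite -f0 mul0r; have [->|c0] := eqVneq (inner mu f g) 0.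
    by rewrite expr0n.
  (* With <f, f> = 0 the form is affine in s, and this s gives it the value -1. *)
  have := expand (- (1 + inner mu g g) / (2 * inner mu f g)) 1.
  rewrite -f0 mulr0 add0r.
  rewrite [_ + _](_ : _ = -1) ?ler0N1//.
  by field.
(* Up to a factor, the minimiser of the form: its value there is a (a b - c^2). *)
have := expand (- inner mu f g) (inner mu f f).
set c := inner mu f g; set b := inner mu g g; set a := inner mu f f.
rewrite -[_ + _](_ : a * (a * b - c ^+ 2) = _); last by ring.
by rewrite pmulr_rge0// subr_ge0.
Qed.

End L2_theory.

(** * Density of simple functions in L^2(mu) *)

Section L2_density.
Context (d : measure_display) (E : measurableType d) (R : realType).
Variable mu : probability E R.
Implicit Types f g h : E -> R.
Import HBNNSimple.

(** Monotone approximation from below keeps 0 <= g_n <= f, so f^2 dominates (f - g_n)^2. *)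
Lemma L2_nnsfun_approx f : (forall x, 0 <= f x) -> L2 mu f ->
  exists g_ : {nnsfun E >-> R}^nat, (forall n, L2 mu (g_ n)) /\
    inner mu (fun x => f x - g_ n x) (fun x => f x - g_ n x)
      @[n --> \oo] --> 0.
Proof.
move=> f0 Lf; have mf := L2_measurable Lf.
have mfE : measurable_fun setT (EFin \o f) by exact/measurable_EFinP.
have [g_ [g_nd g_cvg]] := approximation measurableT mfE
  (fun x _ => f0 x : (0 <= (EFin \o f) x)%E).
have {}g_cvg x : g_ n x @[n --> \oo] --> f x.
  exact: (fine_cvg (g_cvg x I)).
have g_le n x : g_ n x <= f x.
  apply: (cvgr_to_ge (g_cvg x)); near=> m; apply/lefP/g_nd.
  by near: m; exact: nbhs_infty_ge.
have Lg n : L2 mu (g_ n).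
  apply: le_L2 Lf => //.
  by move=> x; rewrite !ger0_norm.
exists g_; split => //.
have mfg n : measurable_fun setT (fun x => (f x - g_ n x) ^+ 2).
  by apply: measurable_funX; exact: measurable_funB.
apply: fine_cvg; rewrite -[X in _ --> X](integral0 mu setT).
have [|||||_ _] := @dominated_convergence _ _ _ mu setT measurableT
    (fun n x => ((f x - g_ n x) * (f x - g_ n x))%:E) (cst 0%E)
    (fun x => (f x ^+ 2)%:E); last by [].
- by move=> n; apply/measurable_EFinP; exact: mfg.
- exact: measurable_cst.
- apply: nearW => x _; apply/fine_cvgP; split; first exact: nearW.
  rewrite [X in _ --> X](_ : _ = (f x - f x) * (f x - f x)).
    by apply: cvgM; (apply: cvgB; [exact: cvg_cst|exact: g_cvg]).
  by rewrite subrr mulr0.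
- by case/L2P: Lf.
- apply: nearW => x n _; rewrite lee_fin -expr2 normrX lerXn2r ?nnegrE//.
  by rewrite ger0_norm ?subr_ge0// lerBlDr lerDl.
Unshelve. all: by end_near. Qed.

(* By density of the simple functions, since [L] is linear and bounded. *)
Lemma L2_functional_eq0 (L : (E -> R) -> R) (C : R) :
  (forall f g, L2 mu f -> L2 mu g -> L (fun x => f x + g x) = L f + L g) ->
  (forall c f, L2 mu f -> L (fun x => c * f x) = c * L f) ->
  (forall f, L2 mu f -> L f ^+ 2 <= C * inner mu f f) ->
  (forall A, measurable A -> L \1_A = 0) ->
  forall f, L2 mu f -> L f = 0.
Proof.
move=> LD LZ LC L1.
have L0 : L (cst 0) = 0.
  have := LZ 0 (cst 0) (L2_cst mu 0); rewrite mul0r.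
  by rewrite (_ : (fun _ => _) = cst 0)//; apply/funext => x; rewrite mulr0.
have Lsimple (g : {nnsfun E >-> R}) : L g = 0.
  (* [S n] truncates the canonical decomposition of [g] over its values, so that linearity can be
     used one term at a time. *)
  pose r i := (fset_set (range g))`_i; pose A i := g @^-1` [set r i].
  pose S n := fun x => \sum_(i < n) (r i * \1_(A i) x).
  have LA i : L2 mu \1_(A i) by apply: L2_indic; rewrite /A.
  have S0 : S 0 = cst 0 by apply/funext => x; rewrite /S big_ord0.
  have SS n : S n.+1 = (fun x => S n x + r n * \1_(A n) x).
    by apply/funext => x; rewrite /S big_ord_recr.
  have LS n : L2 mu (S n).
    elim: n => [|n IH]; first by rewrite S0; exact: L2_cst.
    by rewrite SS; apply: L2D => //; exact: L2Z.
  suff S_eq0 n : L (S n) = 0.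
    rewrite -[RHS](S_eq0 #|`fset_set (range g)|); congr L.
    by apply/funext => x; rewrite fimfunEord.
  elim: n => [|n IH]; first by rewrite S0.
  rewrite SS LD//; last exact: L2Z.
  by rewrite LZ// L1 ?IH ?mulr0 ?addr0// /A.
have Lge0 f : (forall x, 0 <= f x) -> L2 mu f -> L f = 0.
  move=> f0 Lf; have [g_ [Lg gf]] := L2_nnsfun_approx f0 Lf.
  have {}gf : C * inner mu (fun x => f x - g_ n x) (fun x => f x - g_ n x)
      @[n --> \oo] --> C * 0 by apply: cvgM gf; exact: cvg_cst.
  apply/eqP; rewrite -sqrf_eq0; apply/eqP/le_anti; rewrite sqr_ge0 andbT.
  rewrite -(mulr0 C); apply: (cvgr_to_ge gf); near=> n.
  (* [L] vanishes on [g_ n], so (L f)^2 is bounded by C |f - g_ n|^2, which tends to 0. *)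
  have -> : L f = L (fun x => f x - g_ n x); last by apply/LC/L2B.
  rewrite (_ : (fun x => _ - _) = (fun x => f x + -1 * g_ n x)).
    by rewrite LD ?LZ ?Lsimple ?mulr0 ?addr0//; exact: L2Z.
  by apply/funext => x; rewrite mulN1r.
move=> f Lf; have mf := L2_measurable Lf.
have -> : f = (fun x => f^\+ x + -1 * f^\- x).
  by apply/funext => x; rewrite -[in LHS](funrposBneg f) mulN1r.
have Lp : L2 mu f^\+.
  apply: le_L2 Lf; first exact: measurable_funrpos.
  move=> x; rewrite ger0_norm// -[leRHS]/((Num.norm \o f) x) -funrposDneg.
  by rewrite lerDl.
have Ln : L2 mu f^\-.
  apply: le_L2 Lf; first exact: measurable_funrneg.
  move=> x; rewrite ger0_norm// -[leRHS]/((Num.norm \o f) x) -funrposDneg.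
  by rewrite lerDr.
by rewrite LD ?LZ ?Lge0 ?mulr0 ?addr0//; exact: L2Z.
Unshelve. all: by end_near. Qed.

End L2_density.

(** * The kernel at a point as a probability measure *)

Section kernel_measure.
Context (d : measure_display) (E : measurableType d) (R : realType).
Variables (P : R.-pker E ~> E) (x : E).

(* [P x] only comes with a measure structure; this alias makes it a probability,
   so that the theory of L^2 applies to it. *)
Definition kernel_measure : set E -> \bar R := P x.

HB.instance Definition _ := Measure.on kernel_measure.
HB.instance Definition _ :=
  Measure_isProbability.Build _ _ _ kernel_measure (prob_kernel x).

End kernel_measure.

(** * The Markov operator on L^2(mu): contraction, linearity, self-adjointness *)

Section kernel_op_theory.
Context (d : measure_display) (E : measurableType d) (R : realType).
Variables (mu : probability E R) (P : R.-pker E ~> E).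
Implicit Types f g h : E -> R.

(** Stationarity mu P = mu. It carries bounds from the measures [P x] to mu and keeps every X_n
    distributed as mu. *)
Definition kernel_invariant := forall A, measurable A ->
  (\int[mu]_x P x A = mu A)%E.

Lemma reversible_invariant : reversible mu P -> kernel_invariant.
Proof.
move=> hrev A mA; rewrite hrev//.
under eq_integral do rewrite prob_kernel.
by rewrite integral_cst// mul1e.
Qed.

(** Seen as a constant kernel on [unit], mu composes with P to the measure mu P; integrals against a
    composition are iterated integrals, and mu P = mu. *)
Lemma ge0_integral_invariant (h : E -> \bar R) : kernel_invariant ->
  (forall x, 0 <= h x)%E -> measurable_fun setT h ->
  (\int[mu]_x \int[P x]_y h y = \int[mu]_x h x)%E.
Proof.
move=> inv h0 mh.
pose l : R.-sfker unit ~> E :=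
  kprobability (measurable_cst (mu : pprobability E R)).
pose k : R.-sfker (unit * E)%type ~> E := kernel.kernel_snd P.
rewrite -(@integral_kcomp _ _ _ _ _ _ R l k tt h)//.
by apply: eq_measure_integral => A mA _; exact: inv.
Qed.

Lemma measurable_kernel_op f :
  measurable_fun setT f -> measurable_fun setT (kernel_op P f).
Proof.
move=> mf; have mfE : measurable_fun setT (EFin \o f) by exact/measurable_EFinP.
apply: (measurableT_comp (@fine_measurable _ setT measurableT)) => //=.
rewrite (_ : (fun x => _) = (fun x =>
  \int[P x]_y (EFin \o f)^\+ y - \int[P x]_y (EFin \o f)^\- y)%E); last first.
  by apply/funext => x; rewrite integralE.
apply: emeasurable_funB; apply: measurable_fun_integral_kernel => //.
- by move=> U mU; exact: measurable_kernel.
- exact: measurable_funepos.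
- by move=> U mU; exact: measurable_kernel.
- exact: measurable_funeneg.
Qed.

(* If [f] is not square-integrable for [P x], then [kernel_op P f x] may be a
   junk value, but the right-hand side is infinite. *)
Lemma kernel_op_sqr_le f x : measurable_fun setT f ->
  ((kernel_op P f x ^+ 2)%:E <= \int[P x]_y (f y ^+ 2)%:E)%E.
Proof.
move=> mf; have [fi|] := ltP (\int[P x]_y (f y ^+ 2)%:E)%E +oo%E; last first.
  by rewrite leye_eq => /eqP ->; exact: leey.
have Lf : L2 (kernel_measure P x) f.
  apply/L2P; split => //; apply/integrableP; split.
    by apply/measurable_EFinP; exact: measurable_funX.
  by under eq_integral do rewrite gee0_abs ?lee_fin ?sqr_ge0//.
have L1 := L2_cst (kernel_measure P x) 1.
have := cauchy_schwarz Lf L1.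
have -> : inner (kernel_measure P x) f (cst 1) = kernel_op P f x.
  by apply: eq_Rintegral => y _; rewrite mulr1.
have -> : inner (kernel_measure P x) (cst 1) (cst 1) = 1.
  rewrite /inner; under eq_Rintegral do rewrite mulr1.
  by rewrite Rintegral_cst// mul1r [X in fine X](prob_kernel x).
by rewrite mulr1 -lee_fin EFin_inner.
Qed.

Section invariant_kernel.
Hypothesis inv : kernel_invariant.

(** By invariance P(f^2) has the finite mu-integral mu(f^2), hence it is finite almost
    everywhere. *)
Lemma L2_kernel_ae f : L2 mu f ->
  {ae mu, forall x, L2 (kernel_measure P x) f}.
Proof.
move=> Lf; have /L2P[mf fi] := Lf.
have mf2 : measurable_fun setT (fun x => (f x ^+ 2)%:E).
  exact: (measurable_int _ fi).
have f20 x : (0 <= (f x ^+ 2)%:E)%E by rewrite lee_fin sqr_ge0.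
have : mu.-integrable setT (fun x => \int[P x]_y (f y ^+ 2)%:E)%E.
  apply/integrableP; split.
    apply: measurable_fun_integral_kernel => // U mU; exact: measurable_kernel.
  under eq_integral do rewrite gee0_abs ?integral_ge0//.
  by rewrite ge0_integral_invariant//; exact: integrable_lty.
move=> /(integrable_ae measurableT); apply: filterS => x /(_ I) Pf2.
apply/L2P; split => //; apply/integrableP; split => //.
under eq_integral do rewrite gee0_abs//.
by rewrite ltey_eq Pf2.
Qed.

(** The pointwise bound (P f)^2 <= P(f^2), integrated against the invariant mu. It is stated in the
    extended reals because it is what puts P f in L^2. *)
Lemma integral_kernel_op_sqr_le f : L2 mu f ->
  (\int[mu]_x (kernel_op P f x ^+ 2)%:E <= (inner mu f f)%:E)%E.
Proof.
move=> Lf; have /L2P[mf fi] := Lf.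
have mf2 := measurable_int _ fi.
have f20 x : (0 <= (f x ^+ 2)%:E)%E by rewrite lee_fin sqr_ge0.
rewrite EFin_inner// -(ge0_integral_invariant inv f20 mf2).
apply: ge0_le_integral => //.
- by move=> x _; rewrite lee_fin sqr_ge0.
- by apply/measurable_EFinP/measurable_funX; exact: measurable_kernel_op.
- by apply: measurable_fun_integral_kernel => // U mU; exact: measurable_kernel.
- by move=> x _; exact: kernel_op_sqr_le.
Qed.

Lemma L2_kernel_op f : L2 mu f -> L2 mu (kernel_op P f).
Proof.
move=> Lf; apply/L2P; split.
  by apply: measurable_kernel_op; exact: L2_measurable Lf.
apply/integrableP; split.
  apply/measurable_EFinP/measurable_funX; apply: measurable_kernel_op.
  exact: L2_measurable Lf.
under eq_integral do rewrite gee0_abs ?lee_fin ?sqr_ge0//.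
by apply: le_lt_trans (integral_kernel_op_sqr_le Lf) _; exact: ltry.
Qed.

Lemma inner_kernel_op_le f : L2 mu f ->
  inner mu (kernel_op P f) (kernel_op P f) <= inner mu f f.
Proof.
move=> Lf; rewrite -lee_fin EFin_inner; [|exact: L2_kernel_op..].
exact: integral_kernel_op_sqr_le.
Qed.

(** Additivity is claimed only where f and g are both in L^2(P x), as elsewhere the total integral
    may take default values. *)
Lemma kernel_opD_ae f g : L2 mu f -> L2 mu g ->
  ae_eq mu setT (kernel_op P (fun x => f x + g x))
    (fun x => kernel_op P f x + kernel_op P g x).
Proof.
move=> /L2_kernel_ae Lf /L2_kernel_ae Lg.
apply: filterS2 Lf Lg => x Lf Lg _; rewrite /kernel_op.
by rewrite -(@RintegralD _ _ _ (kernel_measure P x))//; exact: L2_integrable.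
Qed.

Lemma kernel_opZ_ae (c : R) f : L2 mu f ->
  ae_eq mu setT (kernel_op P (fun x => c * f x))
    (fun x => c * kernel_op P f x).
Proof.
move=> /L2_kernel_ae; apply: filterS => x Lf _; rewrite /kernel_op.
by rewrite -(@RintegralZl _ _ _ (kernel_measure P x))//; exact: L2_integrable.
Qed.

End invariant_kernel.

Lemma kernel_op_indic A x : measurable A ->
  kernel_op P \1_A x = fine (P x A).
Proof. by move=> mA; rewrite /kernel_op /Rintegral integral_indic// setIT. Qed.

Lemma kernel_op_self_adjoint f g : reversible mu P -> L2 mu f -> L2 mu g ->
  inner mu (kernel_op P f) g = inner mu f (kernel_op P g).
Proof.
move=> hrev; have inv := reversible_invariant hrev.
pose D f g := inner mu (kernel_op P f) g - inner mu f (kernel_op P g).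
have DC f0 g0 : D f0 g0 = - D g0 f0.
  by rewrite /D opprB innerC [in X in _ - X]innerC.
have D0 g0 : L2 mu g0 -> (forall A, measurable A -> D \1_A g0 = 0) ->
    forall f0, L2 mu f0 -> D f0 g0 = 0.
  move=> Lg; have LPg := L2_kernel_op inv Lg.
  (* The 4 comes from (a - b)^2 <= 2 a^2 + 2 b^2, where Cauchy-Schwarz and contraction bound a^2 and
     b^2 by the same product. *)
  apply: (@L2_functional_eq0 _ _ _ mu (D ^~ g0) (4 * inner mu g0 g0)).
  - move=> f1 f2 L1 L2; rewrite /D innerDl//.
    have LP1 := L2_kernel_op inv L1; have LP2 := L2_kernel_op inv L2.
    rewrite (eq_inner_ae _ _ _ (kernel_opD_ae inv L1 L2))//.
    + by rewrite innerDl//; ring.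
    + by apply: (L2_kernel_op inv); exact: L2D.
    + exact: L2D.
  - move=> c f1 L1; rewrite /D innerZl//.
    have LP1 := L2_kernel_op inv L1.
    rewrite (eq_inner_ae _ _ _ (kernel_opZ_ae inv c L1))//.
    + by rewrite innerZl//; ring.
    + by apply: (L2_kernel_op inv); exact: L2Z.
    + exact: L2Z.
  - move=> f1 L1; have LP1 := L2_kernel_op inv L1.
    have := cauchy_schwarz LP1 Lg; have := cauchy_schwarz L1 LPg.
    have := inner_kernel_op_le inv L1; have := inner_kernel_op_le inv Lg.
    have := inner_ge0 mu f1; have := inner_ge0 mu g0; rewrite /D.
    set a := inner mu (kernel_op P f1) g0.
    set b := inner mu f1 (kernel_op P g0).
    set s := inner mu f1 f1; set t := inner mu g0 g0 => t0 s0 Pt Ps h1 h2.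
    have {}h1 : b ^+ 2 <= s * t by apply: le_trans h1 _; rewrite ler_wpM2l.
    have {}h2 : a ^+ 2 <= s * t by apply: le_trans h2 _; rewrite ler_wpM2r.
    have := sqr_ge0 (a + b); nra.
have D1 A B : measurable A -> measurable B -> D \1_A \1_B = 0.
  move=> mA mB; apply/eqP; rewrite subr_eq0; apply/eqP.
  have indicM (U V : set E) : measurable U -> measurable V ->
      inner mu (kernel_op P \1_U) \1_V = fine (\int[mu]_(x in V) P x U)%E.
    move=> mU mV; rewrite integral_mkcond; congr fine.
    apply: eq_integral => x _; rewrite kernel_op_indic// EFinM.
    rewrite fineK; last first.
      exact: (@fin_num_measure _ _ _ (kernel_measure P x)).
    by rewrite patchE indicE; case: (x \in V); rewrite ?mule1 ?mule0.
  by rewrite [RHS]innerC !indicM// hrev.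
move=> Lf Lg; apply/eqP; rewrite -subr_eq0; apply/eqP; apply: (D0 g Lg) => //.
(* [D] is antisymmetric, so the density argument in the first slot serves for the second one too. *)
move=> A mA; rewrite DC (D0 \1_A)//.
- by rewrite oppr0.
- exact: L2_indic.
- by move=> B mB; exact: D1.
Qed.

(** The mean is the inner product with 1, and P 1 = 1. Hence the iterates of a centred f stay
    centred. *)
Lemma mean_kernel_op f : reversible mu P -> L2 mu f ->
  mean mu (kernel_op P f) = mean mu f.
Proof.
move=> hrev Lf; have L1 := L2_cst mu 1.
have mean1 h : mean mu h = inner mu h (cst 1).
  by apply: eq_Rintegral => x _; rewrite mulr1.
rewrite !mean1 kernel_op_self_adjoint//; congr (inner mu f _).
by apply/funext => x; rewrite /kernel_op Rintegral_cst// prob_kernel mulr1.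
Qed.

End kernel_op_theory.

(** * Transfer of L^2(mu) to the sample space through a variable of law mu *)

Section law.
Context (d : measure_display) (E : measurableType d) (R : realType).
Context (d' : measure_display) (Omega : measurableType d').
Variables (Pr : probability Omega R) (mu : probability E R).
Variable Y : {RV Pr >-> E}.
Hypothesis lawY : forall A, measurable A -> Pr (Y @^-1` A) = mu A.
Implicit Types f g : E -> R.

Lemma ge0_integral_law (h : E -> \bar R) : (forall x, 0 <= h x)%E ->
  measurable_fun setT h -> (\int[Pr]_w h (Y w) = \int[mu]_x h x)%E.
Proof.
move=> h0 mh; rewrite -[LHS]/(\int[Pr]_w (h \o Y) w)%E.
rewrite -ge0_integral_distribution//.
by apply: eq_measure_integral => A mA _; exact: lawY.
Qed.

Lemma L2_law f : L2 mu f -> L2 Pr (f \o Y).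
Proof.
move=> /L2P[mf /integrableP[mf2 fi]]; apply/L2P; split.
  exact: measurableT_comp.
apply/integrableP; split; first exact: (measurableT_comp mf2).
by rewrite (ge0_integral_law (h := fun x => `|(f x ^+ 2)%:E|%E))//;
  exact: measurableT_comp.
Qed.

Lemma inner_law f g : L2 mu f -> L2 mu g ->
  inner Pr (f \o Y) (g \o Y) = inner mu f g.
Proof.
move=> Lf Lg; rewrite /inner /Rintegral; congr fine.
have fgi := L2_integrableM Lf Lg.
rewrite -[LHS]/(\int[Pr]_w ((fun x => (f x * g x)%:E) \o Y) w)%E.
rewrite -integral_distribution.
- by apply: eq_measure_integral => A mA _; exact: lawY.
- exact: (measurable_int _ fgi).
- exact: (L2_integrableM (L2_law Lf) (L2_law Lg)).
Qed.

Lemma mean_law f : L2 mu f -> mean Pr (f \o Y) = mean mu f.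
Proof.
move=> Lf; have := inner_law Lf (L2_cst mu 1).
by rewrite /inner; under eq_Rintegral do rewrite mulr1;
  under [in RHS]eq_Rintegral do rewrite mulr1.
Qed.

Lemma ae_eq_law f g : ae_eq mu setT f g -> ae_eq Pr setT (f \o Y) (g \o Y).
Proof.
move=> [N [mN N0 Nsub]]; exists (Y @^-1` N); split.
- by rewrite -[X in measurable X]setTI; exact: measurable_funP.
- by rewrite -N0; exact: lawY.
- by move=> w /= fg; apply: Nsub => /= fgx; apply: fg => _; exact: fgx.
Qed.

End law.

(** * Correlations of the stationary chain *)

Section markov_chain.
Context (d : measure_display) (E : measurableType d) (R : realType).
Context (d' : measure_display) (Omega : measurableType d').
Variables (Pr : probability Omega R) (X : nat -> {RV Pr >-> E}).
Variables (mu : probability E R) (P : R.-pker E ~> E).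
Hypotheses (inv : kernel_invariant mu P) (hX : is_markov_chain X mu P).
Implicit Types f g : E -> R.

(** The Markov clause on the whole sample space gives X_(n+1) the law mu P when X_n has law mu. *)
Lemma chain_law n A : measurable A -> Pr (X n @^-1` A) = mu A.
Proof.
elim: n A => [|n IH] A mA; first exact: hX.1.
have hT : history X n setT.
  have [s0 sC _] := smallest_sigma_algebra setT
    (\bigcup_(i in [set i | (i <= n)%N])
      preimage_set_system setT (X i) measurable).
  by rewrite -(setD0 setT); exact: sC.
have := hX.2 n A setT mA hT; rewrite setTI => ->.
rewrite (ge0_integral_law IH (h := P ^~ A))//.
  exact: inv.
exact: measurable_kernel.
Qed.

Lemma history_preimage i n A : (i <= n)%N -> measurable A ->
  history X n (X i @^-1` A).
Proof.
move=> le_in mA; apply: sub_sigma_algebra; exists i => //.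
by exists A; rewrite ?setTI.
Qed.

(* Both sides are bounded bilinear forms in [f] and [g], and on indicators the
   identity is the Markov property. *)
Lemma chain_step i n f g : (i <= n)%N -> L2 mu f -> L2 mu g ->
  inner Pr (f \o X i) (g \o X n.+1) =
  inner Pr (f \o X i) (kernel_op P g \o X n).
Proof.
move=> le_in.
have LX m h : L2 mu h -> L2 Pr (h \o X m).
  exact: (L2_law (chain_law m)).
have LP h : L2 mu h -> L2 mu (kernel_op P h) by exact: L2_kernel_op.
have LXP m h : L2 mu h -> L2 Pr (kernel_op P h \o X m) by move=> /LP /LX.
have IX m h : L2 mu h -> inner Pr (h \o X m) (h \o X m) = inner mu h h.
  by move=> Lh; rewrite (inner_law (chain_law m)).
pose D f g := inner Pr (f \o X i) (g \o X n.+1) -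
  inner Pr (f \o X i) (kernel_op P g \o X n).
have Dle f0 g0 : L2 mu f0 -> L2 mu g0 ->
    D f0 g0 ^+ 2 <= 4 * (inner mu f0 f0 * inner mu g0 g0).
  move=> Lf Lg.
  have := cauchy_schwarz (LX i _ Lf) (LX n.+1 _ Lg).
  have := cauchy_schwarz (LX i _ Lf) (LXP n _ Lg).
  rewrite !IX//; last exact: LP.
  have := inner_kernel_op_le inv Lg.
  have := inner_ge0 mu f0; rewrite /D.
  set a := inner Pr _ (g0 \o _); set b := inner Pr _ _.
  set s := inner mu f0 f0; set t := inner mu g0 g0 => s0 Pt h1 h2.
  have {}h1 : b ^+ 2 <= s * t by apply: le_trans h1 _; rewrite ler_wpM2l.
  have := sqr_ge0 (a + b); nra.
have D1 A B : measurable A -> measurable B -> D \1_A \1_B = 0.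
  move=> mA mB; apply/eqP; rewrite subr_eq0; apply/eqP.
  (* The condition i <= n enters here: the event on [X i] belongs to the past of time n. *)
  have := hX.2 n B (X i @^-1` A) mB (history_preimage le_in mA).
  move=> /(congr1 fine) h.
  transitivity (fine (Pr (X i @^-1` A `&` X n.+1 @^-1` B))).
    rewrite /inner /Rintegral -[X in Pr X]setIT -integral_indic//; last first.
      by apply: measurableI; rewrite -[X in measurable X]setTI;
        exact: measurable_funP.
    congr fine; apply: eq_integral => w _; congr EFin => /=.
    by rewrite !indicE in_setI -natrM mulnb.
  rewrite h integral_mkcond; congr fine; apply: eq_integral => w _ /=.
  rewrite kernel_op_indic// EFinM fineK; last first.
    exact: (@fin_num_measure _ _ _ (kernel_measure P (X n w))).
  by rewrite patchE indicE -[X i w \in A]/(w \in X i @^-1` A);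
    case: (w \in _); rewrite ?mul1e ?mul0e.
have D1r A : measurable A -> forall f0, L2 mu f0 -> D f0 \1_A = 0.
  move=> mA; have LA := L2_indic mu mA.
  apply: (@L2_functional_eq0 _ _ _ mu (D ^~ \1_A) (4 * inner mu \1_A \1_A)).
  - move=> f1 f2 Lf1 Lf2; rewrite /D.
    have e : (fun x => f1 x + f2 x) \o X i =
      (fun w => (f1 \o X i) w + (f2 \o X i) w) by [].
    have := LX i _ Lf1; have := LX i _ Lf2; have := LX n.+1 _ LA.
    by have := LXP n _ LA => *; rewrite e !innerDl//; ring.
  - move=> c f1 Lf1; rewrite /D.
    have e : (fun x => c * f1 x) \o X i = (fun w => c * (f1 \o X i) w) by [].
    have := LX i _ Lf1; have := LX n.+1 _ LA.
    by have := LXP n _ LA => *; rewrite e !innerZl//; ring.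
  - by move=> f1 Lf1; rewrite -mulrA (mulrC (inner mu \1_A _)); exact: Dle.
  - by move=> B mB; exact: D1.
move=> Lf; suff D0 : forall g0, L2 mu g0 -> D f g0 = 0.
  by move=> Lg; apply/eqP; rewrite -subr_eq0; apply/eqP; exact: D0.
apply: (@L2_functional_eq0 _ _ _ mu (D f) (4 * inner mu f f)).
- move=> g1 g2 Lg1 Lg2; rewrite /D.
  have e : (fun x => g1 x + g2 x) \o X n.+1 =
    (fun w => (g1 \o X n.+1) w + (g2 \o X n.+1) w) by [].
  rewrite e innerDr//; [|exact: LX..].
  rewrite ![inner Pr (f \o X i) (kernel_op P _ \o _)]innerC.
  (* P is additive off a mu-null set, whose preimage under [X n] is Pr-null because [X n] has law
     mu. *)
  have k := ae_eq_law (chain_law n) (kernel_opD_ae inv Lg1 Lg2).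
  rewrite (eq_inner_ae _ _ _ k).
  + have e' : (fun x => kernel_op P g1 x + kernel_op P g2 x) \o X n =
      (fun w => (kernel_op P g1 \o X n) w + (kernel_op P g2 \o X n) w) by [].
    have := LX i _ Lf; have := LXP n _ Lg1.
    by have := LXP n _ Lg2 => *; rewrite e' innerDl//; ring.
  + by apply: LXP; exact: L2D.
  + by apply: LX; apply: L2D; exact: LP.
  + exact: LX.
- move=> c g1 Lg1; rewrite /D.
  have e : (fun x => c * g1 x) \o X n.+1 =
    (fun w => c * (g1 \o X n.+1) w) by [].
  rewrite e innerZr//; [|exact: LX..].
  rewrite ![inner Pr (f \o X i) (kernel_op P _ \o _)]innerC.
  have k := ae_eq_law (chain_law n) (kernel_opZ_ae inv c Lg1).
  rewrite (eq_inner_ae _ _ _ k).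
  + have e' : (fun x => c * kernel_op P g1 x) \o X n =
      (fun w => c * (kernel_op P g1 \o X n) w) by [].
    have := LX i _ Lf.
    by have := LXP n _ Lg1 => *; rewrite e' innerZl//; ring.
  + by apply: LXP; exact: L2Z.
  + by apply: LX; apply: L2Z; exact: LP.
  + exact: LX.
- by move=> g1 Lg1; rewrite -mulrA; exact: Dle.
- by move=> A mA; exact: D1r.
Qed.

Lemma L2_iter_kernel_op k f : L2 mu f -> L2 mu (iter k (kernel_op P) f).
Proof. by move=> Lf; elim: k => //= k; exact: L2_kernel_op. Qed.

(** Each use of [chain_step] trades the last time step for one P applied to g, so the induction must
    let g vary. *)
Lemma chain_correlation i k f g : L2 mu f -> L2 mu g ->
  inner Pr (f \o X i) (g \o X (i + k)%N) = inner mu f (iter k (kernel_op P) g).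
Proof.
move=> Lf; elim: k g => [|k IH] g Lg.
  by rewrite addn0 (inner_law (chain_law i)).
rewrite addnS chain_step ?leq_addr// IH ?iterSr//.
exact: L2_kernel_op.
Qed.

End markov_chain.

(** * The variance of ergodic averages as a Cesaro mean *)

Section chain_variance.
Context (d : measure_display) (E : measurableType d) (R : realType).
Context (d' : measure_display) (Omega : measurableType d').
Variables (Pr : probability Omega R) (X : nat -> {RV Pr >-> E}).
Variables (mu : probability E R) (P : R.-pker E ~> E).
Hypotheses (inv : kernel_invariant mu P) (hX : is_markov_chain X mu P).
Variable f : E -> R.
Hypothesis hf : L20 mu f.

Definition autocorrelation k : R := inner mu f (iter k (kernel_op P) f).

(** The growth of |T n|^2 from n to n + 1: the variance of the new term plus twice its covariance
    with the past. *)
Definition variance_increment n : R :=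
  autocorrelation 0 + 2 * series (fun k => autocorrelation k.+1) n.

Let T n w := \sum_(0 <= j < n) f (X j.+1 w).

Let LX n : L2 Pr (f \o X n).
Proof. by apply: (L2_law (chain_law inv hX n)); exact: hf.1. Qed.

Let TS n : T n.+1 = (fun w => T n w + (f \o X n.+1) w).
Proof. by apply/funext => w; rewrite /T big_nat_recr. Qed.

Let T0 : T 0 = cst 0.
Proof. by apply/funext => w; rewrite /T big_geq. Qed.

Let LT n : L2 Pr (T n).
Proof.
elim: n => [|n IH]; first by rewrite T0; exact: L2_cst.
by rewrite TS; exact: L2D.
Qed.

Let inner_TX n g : L2 Pr g ->
  inner Pr (T n) g = \sum_(0 <= j < n) inner Pr (f \o X j.+1) g.
Proof.
move=> Lg; elim: n => [|n IH].
  rewrite T0 big_geq// /inner; under eq_Rintegral do rewrite mul0r.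
  by rewrite Rintegral_cst// mul0r.
by rewrite TS innerDl// IH big_nat_recr.
Qed.

Let inner_TT n : inner Pr (T n) (T n) = series variance_increment n.
Proof.
elim: n => [|n IH]; first by rewrite inner_TX// /series/= !big_geq.
rewrite TS; have L1 := LT n; have L2 := LX n.+1.
rewrite innerDl ?innerDr//; [|exact: L2D..].
rewrite (innerC _ (f \o _) (T n)) IH seriesSr inner_TX// -!addrA; congr (_ + _).
rewrite (inner_law (chain_law inv hX n.+1))//; [|exact: hf.1..].
rewrite /variance_increment addrCA addrA addrC; congr (_ + _).
rewrite -mulr2n -[LHS]mulr_natl; congr (_ * _).
(* Reversing the sum puts the j-th past time at n - j, which is at lag j + 1 from time n + 1. *)
rewrite /series/= big_nat_rev/= !big_mkord; apply: eq_bigr => j _.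
have lejn := ltn_ord j.
rewrite /autocorrelation.
rewrite -(chain_correlation inv hX (0 + n - j.+1).+1 j.+1)//; [|exact: hf.1..].
by congr (inner Pr _ (f \o X _)); lia.
Qed.

Let mean_T n : mean Pr (T n) = 0.
Proof.
have -> : mean Pr (T n) = inner Pr (T n) (cst 1).
  by apply: eq_Rintegral => w _; rewrite mulr1.
rewrite inner_TX ?big1//; last exact: L2_cst.
move=> j _; rewrite -[RHS]hf.2 -(mean_law (chain_law inv hX j.+1) hf.1).
by apply: eq_Rintegral => w _; rewrite mulr1.
Qed.

Lemma scaled_varianceE n :
  scaled_variance X f n = (n%:R^-1 * series variance_increment n)%:E.
Proof.
rewrite /scaled_variance.
have -> : (fun w => n%:R^-1 * \sum_(1 <= i < n.+1) f (X i w)) = n%:R^-1 \o* T n.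
  by apply/funext => w /=; rewrite big_add1/= mulrC.
rewrite varianceZ; last exact: LT.
rewrite varianceE; last exact: LT.
have -> : ('E_Pr[T n] = 0)%E.
  rewrite unlock.
  rewrite -(fineK (integrable_fin_num measurableT (L2_integrable (LT n)))).
  by rewrite -[fine _]/(mean Pr (T n)) mean_T.
have -> : ('E_Pr[T n ^+ 2] = (series variance_increment n)%:E)%E.
  by rewrite unlock -inner_TT EFin_inner//; apply: LT.
rewrite expe2 mule0 sube0 -!EFinM; congr EFin; rewrite mulrA; congr (_ * _).
(* At n = 0 both sides vanish, the inverse of 0 being 0. *)
have [->|n0] := eqVneq n 0%N; first by rewrite mul0r invr0.
by rewrite expr2 mulrA divff ?mul1r// pnatr_eq0.
Qed.

Lemma cvg_scaled_variance (l : R) : variance_increment n @[n --> \oo] --> l ->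
  scaled_variance X f n @[n --> \oo] --> l%:E.
Proof.
(* [arithmetic_mean] at n averages n + 1 terms, hence the shift. *)
move=> cl; rewrite -cvg_shiftS; apply/fine_cvgP; split.
  by apply: nearW => n; rewrite /= scaled_varianceE.
rewrite (_ : _ \o _ = arithmetic_mean variance_increment); first exact: cesaro.
by apply/funext => n; rewrite /= scaled_varianceE.
Qed.

End chain_variance.

(** * The conjugate K* and the function B *)

Section rate.
Context (R : realType).
Variable beta : R -> R.
Hypothesis hbeta : is_rate beta.
Implicit Types v w t : R.
Local Open Scope ereal_scope.

Lemma Kfun_ge0 u : (0 <= Kfun beta u)%R.
Proof.
rewrite /Kfun; case: ifPn => // u0; apply: mulr_ge0; first exact: ltW.
by apply: (rate_ge0 hbeta); rewrite invr_gt0.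
Qed.

Lemma Kstar_ge0 v : 0 <= Kstar beta v.
Proof.
apply: ereal_sup_ubound; exists 0%R => //=.
by rewrite mul0r /Kfun ltxx subrr.
Qed.

(** Since K >= 0 and t <= 1, each u satisfies t u v - K(u) <= t (u v - K(u)). *)
Lemma Kstar_scale t v : (0 <= t <= 1)%R ->
  Kstar beta (t * v) <= t%:E * Kstar beta v.
Proof.
move=> /andP[t0 t1]; apply: ge_ereal_sup => _ [u u0 <-].
apply: (@le_trans _ _ (t%:E * (u * v - Kfun beta u)%:E)).
  rewrite -EFinM lee_fin; have := Kfun_ge0 u; nra.
by apply: lee_wpmul2l => //; apply: ereal_sup_ubound; exists u.
Qed.

(** Scaling by t = v / w. Where K* is infinite the ratio is 0, where K* vanishes it is infinite, and
    both conventions agree with the monotonicity. *)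
Lemma ratio_nonincreasing v w : (0 < v)%R -> (v <= w)%R ->
  w%:E / Kstar beta w <= v%:E / Kstar beta v.
Proof.
move=> v0 vw; have w0 : (0 < w)%R by exact: lt_le_trans vw.
have vw1 : (0 <= v / w <= 1)%R.
  by rewrite ler_pdivrMr// mul1r vw andbT divr_ge0// ltW.
have := Kstar_scale w vw1; rewrite divfK ?gt_eqF//.
have := Kstar_ge0 v; have := Kstar_ge0 w.
case: (Kstar beta w) => [r| |]//; last first.
  by move=> _ v00 _; rewrite invey mule0 mule_ge0// ?inve_ge0// lee_fin ltW.
case: (Kstar beta v) => [s| |]//; rewrite !lee_fin => r0.
rewrite le_eqVlt => /predU1P[<-|s0] sr.
  by rewrite inve0 gt0_muley ?lte_fin// leey.
have r1 : (0 < r)%R.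
  by move: (lt_le_trans s0 sr); rewrite pmulr_rgt0// divr_gt0.
rewrite !inver !gt_eqF// -!EFinM lee_fin ler_pdivrMr// mulrAC ler_pdivlMr//.
by move: sr; rewrite mulrAC ler_pdivlMr// (mulrC s).
Qed.

(** Superlevel sets of a nonincreasing function are intervals. *)
Lemma measurable_ratio : measurable_fun (`]0%R, +oo[%classic : set R)
  (fun w : R => w%:E / Kstar beta w).
Proof.
move=> mD; apply: (measurability _ (ErealGenOInfty.measurableE R)) => //.
move=> /= _ [_ [x ->] <-]; apply: is_interval_measurable => a b /=.
rewrite !in_itv/= !andbT => -[a0 ax] [b0 bx] c /andP[ac cb].
have c0 : (0 < c)%R by exact: lt_le_trans ac.
rewrite !in_itv/= !andbT; split => //; apply: lt_le_trans bx _.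
exact: ratio_nonincreasing.
Qed.

Lemma ratio_ge0 w : (0 <= w)%R -> 0 <= w%:E / Kstar beta w.
Proof. by move=> w0; rewrite mule_ge0 ?lee_fin ?inve_ge0 ?Kstar_ge0. Qed.

Lemma Bfun_ge v w : (0 <= v)%R -> (v < w)%R ->
  Bfun beta v + (w%:E / Kstar beta w) * (w - v)%:E <= Bfun beta w.
Proof.
move=> v0 vw; have w0 : (0 < w)%R by exact: le_lt_trans vw.
have mg (D : set R) : measurable D -> D `<=` `]0%R, +oo[ ->
    measurable_fun D (fun w : R => w%:E / Kstar beta w).
  by move=> mD D0; apply: measurable_funS measurable_ratio.
have sub0 (x : R) : (`]0%R, x]%classic : set R) `<=` `]0%R, +oo[.
  by move=> y /=; rewrite !in_itv/= andbT => /andP[].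
(* The ratio is 0 at 0, where monotonicity may fail; this null point is dropped. *)
have BE x : Bfun beta x = \int[lebesgue_measure]_(y in `]0%R, x])
    (y%:E / Kstar beta y).
  by rewrite /Bfun integral_itv_obnd_cbnd//; exact: mg.
have vw_sub : (`]v, w]%classic : set R) `<=` `]0%R, +oo[.
  by move=> y /=; rewrite !in_itv/= andbT => /andP[+ _]; exact: le_lt_trans.
rewrite !BE (_ : `]0%R, w]%classic = `]0%R, v] `|` `]v, w]); last first.
  by rewrite -itv_bndbnd_setU// bnd_simp// ltW.
rewrite ge0_integral_setU//=; last 3 first.
- apply: mg; first exact: measurableU.
  by move=> y [/sub0|/vw_sub].
- move=> y [/sub0|/vw_sub]; rewrite /= in_itv/= andbT => /ltW;
    exact: ratio_ge0.
- apply/disj_setPLR => y /=; rewrite !in_itv/= => /andP[_ yv].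
  by rewrite ltNge yv.
apply: leeD => //.
have <- : \int[lebesgue_measure]_(y in `]v, w]) (cst (w%:E / Kstar beta w) y) =
    w%:E / Kstar beta w * (w - v)%:E.
  by rewrite integral_cst//= lebesgue_measure_itv/= lte_fin vw EFinB.
apply: ge0_le_integral => //.
- by move=> y _; apply: ratio_ge0; exact: ltW.
- exact: mg.
- move=> y /=; rewrite in_itv/= => /andP[vy yw].
  by apply: ratio_nonincreasing => //; exact: le_lt_trans vy.
Qed.

(** On ]v, w] the integrand is at least w / K*(w), and (w - v) w / K*(w) >= w. The additive form
    avoids subtracting infinite values. *)
Lemma Bfun_step v w : (0 <= v)%R -> (v <= w)%R ->
  Kstar beta w <= (w - v)%:E -> w%:E + Bfun beta v <= Bfun beta w.
Proof.
move=> v0 vw; have := le_trans v0 vw; rewrite le_eqVlt => /predU1P[w0|w0].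
  have -> : v = 0%R by apply/le_anti; rewrite v0 w0 vw.
  by rewrite -w0 add0e.
(* If K*(w) = 0, the integrand is infinite on all of ]0, w], so B(w) is infinite. *)
have := Kstar_ge0 w; rewrite le_eqVlt => /predU1P[K0|].
  have := Bfun_ge (lexx 0%R) w0.
  rewrite -K0 inve0 gt0_muley ?lte_fin// subr0 gt0_mulye ?lte_fin//.
  rewrite addey; first by rewrite leye_eq => /eqP -> _; exact: leey.
  rewrite gt_eqF// (lt_le_trans ltNy0)//; apply: integral_ge0 => x /=.
  by rewrite in_itv/= => /andP[x0 _]; exact: ratio_ge0.
case E : (Kstar beta w) => [k| |]//; rewrite lte_fin lee_fin => k0 kwv.
have vw' : (v < w)%R by rewrite -subr_gt0; exact: lt_le_trans kwv.
apply: le_trans (Bfun_ge v0 vw'); rewrite addeC leeD2l//.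
rewrite E inver gt_eqF// -!EFinM lee_fin mulrAC ler_pdivlMr//.
by rewrite ler_pM2l.
Qed.

End rate.

(** * Summability of the autocorrelations under reversibility *)

Section reversible_autocorrelation.
Context (d : measure_display) (E : measurableType d) (R : realType).
Variables (mu : probability E R) (P : R.-pker E ~> E).
Hypothesis hrev : reversible mu P.
Variable f : E -> R.
Hypothesis Lf : L2 mu f.

Local Notation iterP k := (iter k (kernel_op P) f).
Local Notation a := (autocorrelation mu P f).
Local Notation b k := (inner mu (iterP k) (iterP k)).

Let inv : kernel_invariant mu P := reversible_invariant hrev.

Let LPk k : L2 mu (iterP k). Proof. exact: L2_iter_kernel_op. Qed.

Lemma autocorrelationD m n : a (m + n) = inner mu (iterP m) (iterP n).
Proof.
rewrite /autocorrelation; elim: m n => [//|m IH] n.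
by rewrite addSnnS IH/= (kernel_op_self_adjoint hrev (LPk m) (LPk n)).
Qed.

Lemma inner_iter_nonincreasing k : b k.+1 <= b k.
Proof. exact: (inner_kernel_op_le inv (LPk k)). Qed.

(** Splitting n into h = [n./2] and h + [odd n], Cauchy-Schwarz bounds a_n^2 by b_h b_(h + odd n),
    and b is nonincreasing. *)
Lemma normr_autocorrelation_le n : `|a n| <= b n./2.
Proof.
rewrite -[in leLHS](odd_double_half n) -addnn addnA addnC autocorrelationD.
rewrite -ler_sqr ?nnegrE ?inner_ge0// real_normK ?num_real//.
apply: le_trans (cauchy_schwarz (LPk _) (LPk _)) _.
rewrite expr2 ler_wpM2l ?inner_ge0//.
by case: (odd n) => //=; exact: inner_iter_nonincreasing.
Qed.

(** Each b_k serves the two lags 2k and 2k + 1; the sum is first padded from N to 2N terms. *)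
Lemma sum_normr_autocorrelation_le N :
  \sum_(0 <= n < N) `|a n| <= 2 * \sum_(0 <= k < N) b k.
Proof.
have double : \sum_(0 <= n < N.*2) b n./2 = 2 * \sum_(0 <= k < N) b k.
  elim: N => [|N IH]; first by rewrite !big_geq// mulr0.
  rewrite doubleS !big_nat_recr//= IH uphalf_double doubleK; ring.
rewrite -double; apply: (@le_trans _ _ (\sum_(0 <= n < N) b n./2)).
  by apply: ler_sum => n _; exact: normr_autocorrelation_le.
rewrite [leRHS](big_cat_nat _ (n := N))//=; last by lia.
by rewrite lerDl; apply: sumr_ge0 => n _; exact: inner_ge0.
Qed.

(** The series converges absolutely, and a_0 + 2 (a_1 + ... + a_n) is at most twice the sum of the
    |a_j|, itself at most 2 M. *)
Lemma cvg_variance_increment M : (forall N, \sum_(0 <= k < N) b k <= M) ->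
  exists2 l, variance_increment mu P f n @[n --> \oo] --> l & l <= 4 * M.
Proof.
move=> bM; have normM N : \sum_(0 <= n < N) `|a n| <= 2 * M.
  by apply: le_trans (sum_normr_autocorrelation_le N) _; rewrite ler_pM2l.
have shift n : \sum_(0 <= j < n) `|a j.+1| =
      \sum_(0 <= j < n.+1) `|a j| - `|a 0|.
  by rewrite big_nat_recl// addrAC subrr add0r.
have scvg : cvgn (series (fun k => a k.+1)).
  apply: normed_cvg; apply: nondecreasing_is_cvgn.
    by apply: nondecreasing_series => n _ _ /=.
  exists (2 * M) => _ [n _ <-]; 
  rewrite -[leLHS]/(\sum_(0 <= j < n) `|a j.+1|) shift.
  by apply: le_trans (normM n.+1); rewrite gerBl.
have cl : variance_increment mu P f n @[n --> \oo] -->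
    a 0 + 2 * limn (series (fun k => a k.+1)).
  by apply: cvgD; [exact: cvg_cst|apply: cvgM => //; exact: cvg_cst].
exists (a 0 + 2 * limn (series (fun k => a k.+1))) => //.
apply: (cvgr_to_le cl); apply: nearW => n.
have := normM n.+1; have := shift n; have := ler_norm (a 0).
have := normr_ge0 (a 0).
have : series (fun k => a k.+1) n <= \sum_(0 <= j < n) `|a j.+1|.
  by apply: ler_sum => j _; exact: ler_norm.
rewrite /variance_increment; lra.
Qed.

End reversible_autocorrelation.

(** * Decay of |P^k f|^2 from the functional inequality *)

Section sieve_decay.
Context (d : measure_display) (E : measurableType d) (R : realType).
Variables (mu : probability E R) (P : R.-pker E ~> E).
Variables (Pstar : (E -> R) -> E -> R) (Phi : (E -> R) -> \bar R).
Variable beta : R -> R.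
Hypotheses (hrev : reversible mu P) (hadj : is_adjoint mu (kernel_op P) Pstar).
Hypotheses (hPhi : is_sieve mu Phi) (hnonexp : nonexpansive mu Phi P).
Hypothesis hbeta : is_rate beta.
Hypothesis hK : (forall f : E -> R, L20 mu f -> 0 < Phi f -> Phi f < +oo ->
    (dirichlet mu (Pstar \o kernel_op P) f)%:E / Phi f
      >= Kstar beta (sqnorm mu f / fine (Phi f))%R)%E.
Hypothesis hB : (forall v : R, (0 <= v)%R -> v%:E <= sieve_const mu Phi ->
    Bfun beta v < +oo)%E.
Variable f : E -> R.
Hypotheses (hf : L20 mu f) (hPhi0 : (0 < Phi f)%E) (hPhioo : (Phi f < +oo)%E).

Local Notation iterP k := (iter k (kernel_op P) f).
Local Notation b k := (inner mu (iterP k) (iterP k)).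
Local Notation phi := (fine (Phi f)).

Let inv : kernel_invariant mu P := reversible_invariant hrev.

(** The form of P*P is the loss of squared norm in one step, which lets the inequality telescope
    along the iterates. *)
Lemma dirichlet_adjoint g : L2 mu g -> dirichlet mu (Pstar \o kernel_op P) g =
  inner mu g g - inner mu (kernel_op P g) (kernel_op P g).
Proof.
move=> Lg; have LPg := L2_kernel_op inv Lg.
rewrite /dirichlet (innerBl Lg _ Lg) /=; last exact: hadj.1.
by rewrite (innerC _ (Pstar _)) -hadj.2.
Qed.

Let L20_iter k : L20 mu (iterP k).
Proof.
elim: k => [//|k [Lk mk]]; split; first exact: L2_kernel_op.
by rewrite /= mean_kernel_op.
Qed.

Let Phi_iter k : (Phi (iterP k) <= Phi f)%E.
Proof.
elim: k => [|k]; first exact: lexx.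
by apply: le_trans; exact: (hnonexp (L20_iter k)).
Qed.

Let sqnorm_le_sieve g : L20 mu g ->
  ((inner mu g g)%:E <= sieve_const mu Phi * Phi g)%E.
Proof.
move=> [Lg mg]; have := sieve_bound hPhi Lg.
rewrite mg (_ : (fun x => g x - 0) = g); first by rewrite sqnormE.
by apply/funext => x; rewrite subr0.
Qed.

Let sieve_const_ge0 : (0 <= sieve_const mu Phi)%E.
Proof. by rewrite /sieve_const le_max lexx. Qed.

Let phi_gt0 : 0 < phi. Proof. by rewrite fine_gt0// hPhi0 hPhioo. Qed.

Let PhiE : Phi f = phi%:E.
Proof. by rewrite fineK// ge0_fin_numE ?ltW. Qed.

Lemma Kstar_iter_le k :
  (Kstar beta (b k / phi) <= (b k / phi - b k.+1 / phi)%:E)%E.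
Proof.
have bS : b k.+1 <= b k by exact: (inner_iter_nonincreasing hrev hf.1).
have [Lk mk] := L20_iter k.
(* When Phi(P^k f) = 0, the sieve bound gives b_k = 0, and only K*(0) <= 0 is left, which is scaling
   with t = 0. *)
have := sieve_ge0 hPhi Lk; rewrite le_eqVlt => /predU1P[Phik0|Phik0].
  have := sqnorm_le_sieve (L20_iter k); rewrite -Phik0 mule0 lee_fin => bk.
  have {}bk : b k = 0 by apply/le_anti; rewrite bk inner_ge0.
  have {}bS : b k.+1 = 0 by apply/le_anti; rewrite inner_ge0 andbT -bk.
  rewrite bk bS !mul0r subrr.
  have := Kstar_scale hbeta 0 (t := 0).
  by rewrite lexx ler01 mul0e mulr0; exact.
have Phikoo : (Phi (iterP k) < +oo)%E by exact: le_lt_trans (Phi_iter k) _.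
have := hK (L20_iter k) Phik0 Phikoo.
have := Phi_iter k; rewrite PhiE.
move: Phik0 Phikoo; case: (Phi (iterP k)) => [p| |]//=.
rewrite lte_fin lee_fin => p0 _ pphi.
rewrite dirichlet_adjoint// sqnormE// inver gt_eqF// -EFinM => Kp.
(* The inequality at P^k f is normalised by p = Phi(P^k f); scaling by p / phi replaces p by the
   fixed phi. *)
have tp : 0 <= p / phi <= 1.
  by rewrite ler_pdivrMr// mul1r pphi andbT divr_ge0// ltW.
have := Kstar_scale hbeta (b k / p) tp.
rewrite (_ : p / phi * (b k / p) = b k / phi); last first.
  by field; rewrite !gt_eqF.
move=> /le_trans; apply.
have tp0 : (0 <= (p / phi)%:E)%E by rewrite lee_fin; case/andP: tp.
apply: le_trans (lee_wpmul2l tp0 Kp) _; rewrite -EFinM lee_fin.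
rewrite le_eqVlt; apply/orP; left; apply/eqP.
by field; rewrite !gt_eqF.
Qed.

Lemma Bfun_initial_lty : (Bfun beta (inner mu f f / phi) < +oo)%E.
Proof.
apply: hB; first by rewrite divr_ge0 ?inner_ge0// ltW.
have := sqnorm_le_sieve hf; rewrite PhiE.
have := sieve_const_lty hPhi; move: sieve_const_ge0.
case: (sieve_const mu Phi) => [s| |]// _ _.
by rewrite -EFinM !lee_fin ler_pdivrMr.
Qed.

Lemma sum_inner_iter_le N :
  \sum_(0 <= k < N) b k <= phi * fine (Bfun beta (inner mu f f / phi)).
Proof.
have b0 k : 0 <= b k / phi by rewrite divr_ge0 ?inner_ge0// ltW.
have B0 k : (0 <= Bfun beta (b k / phi))%E.
  apply: integral_ge0 => x /=.
  by rewrite in_itv/= => /andP[x0 _]; exact: ratio_ge0.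
(* Keeping the remainder B(v_N) on the left makes the telescoping an induction without
   subtraction. *)
have : ((\sum_(0 <= k < N) (b k / phi))%:E + Bfun beta (b N / phi) <=
    Bfun beta (inner mu f f / phi))%E.
  elim: N => [|N IH]; first by rewrite big_geq// add0e.
  apply: le_trans IH; rewrite big_nat_recr//= EFinD -addeA leeD2l//.
  apply: Bfun_step => //; [exact: (b0 N.+1)| |exact: Kstar_iter_le].
  rewrite ler_pM2r ?invr_gt0//.
  exact: (inner_iter_nonincreasing hrev hf.1).
move=> /(le_trans (leeDl _ (B0 N))).
rewrite -mulr_suml -[X in (_ <= X)%E]fineK; last first.
  by rewrite ge0_fin_numE; [exact: Bfun_initial_lty|exact: (B0 0)].
by rewrite lee_fin ler_pdivrMr// mulrC.
Qed.

End sieve_decay.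

(** * From the summed decay to the asymptotic variance *)

Local Open Scope ereal_scope.

Theorem theorem17 (R : realType) (d : measure_display) (E : measurableType d)
  (mu : probability E R) (P : R.-pker E ~> E)
  (Pstar : (E -> R) -> E -> R)
  (Phi : (E -> R) -> \bar R) (beta : R -> R)
  (d' : measure_display) (Omega : measurableType d')
  (Pr : probability Omega R) (X : nat -> {RV Pr >-> E})
  (hrev : reversible mu P)
  (hadj : is_adjoint mu (kernel_op P) Pstar)
  (hPhi : is_sieve mu Phi)
  (hnonexp : nonexpansive mu Phi P)
  (hbeta : is_rate beta)
  (hK : forall f : E -> R, L20 mu f -> 0 < Phi f -> Phi f < +oo ->
    (dirichlet mu (Pstar \o kernel_op P) f)%:E / Phi f
      >= Kstar beta (sqnorm mu f / fine (Phi f))%R)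
  (hincr : forall v w : R, (0 < v)%R -> (v <= w)%R ->
    w%:E <= sieve_const mu Phi ->
    v%:E - Kstar beta v <= w%:E - Kstar beta w)
  (hB : forall v : R, (0 <= v)%R -> v%:E <= sieve_const mu Phi ->
    Bfun beta v < +oo)
  (hX : is_markov_chain X mu P)
  (f : E -> R) (hf : L20 mu f) (hPhi0 : 0 < Phi f) (hPhioo : Phi f < +oo) :
  cvgn (scaled_variance X f) /\
  asymptotic_variance X f <=
    4%:E * Phi f * Bfun beta (sqnorm mu f / fine (Phi f))%R.
Proof.
have inv := reversible_invariant hrev; have Lf := hf.1.
have phiE : Phi f = (fine (Phi f))%:E by rewrite fineK// ge0_fin_numE ?ltW.
have [l cl lM] := cvg_variance_increment hrev Lf
  (sum_inner_iter_le hrev hadj hPhi hnonexp hbeta hK hB hf hPhi0 hPhioo).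
have cv := cvg_scaled_variance inv hX hf cl.
split; first by apply/cvg_ex; exists l%:E.
(* [limn] is total, so its value is known only through the convergence [cv]. *)
rewrite /asymptotic_variance (cvg_lim _ cv)// sqnormE// phiE.
have Bfin : Bfun beta (inner mu f f / fine (Phi f))%R \is a fin_num.
  rewrite ge0_fin_numE.
    exact: (Bfun_initial_lty hPhi hB hf hPhi0 hPhioo).
  apply: integral_ge0 => x /=.
  by rewrite in_itv/= => /andP[x0 _]; exact: ratio_ge0.
by rewrite -(fineK Bfin) -!EFinM lee_fin -mulrA.
Qed.
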